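(* For any $\lambda>0$ and any $0<\alpha<1/2$, the nonlocal mean curvature of the helicoid $H_\lambda\subset\mathbb{R}^3$ vanishes identically: $\mathcal{H}^{2\alpha}_{H_\lambda}(x)=0$ for every $x\in H_\lambda$.
   Context: Identify $\mathbb{R}^3=\mathbb{C}\times\mathbb{R}$. For $\lambda>0$, the helicoid is $H_\lambda=\{(te^{i\theta},\frac{\lambda}{\pi}\theta): t,\theta\in\mathbb{R}\}$. Its complement $\mathbb{R}^3\setminus H_\lambda$ has exactly two connected components, $$E_+=\{(te^{i\theta},\tfrac{\lambda}{\pi}(\theta+z)): t>0,\ \theta\in\mathbb{R},\ z\in(0,\pi)\},\qquad E_-=\{(te^{i\theta},\tfrac{\lambda}{\pi}(\theta+z)): t<0,\ \theta\in\mathbb{R},\ z\in(0,\pi)\}.$$ For $0<\alpha<1/2$ and a measurable set $E\subset\mathbb{R}^n$, the nonlocal mean curvature of $E$ at $x\in\partial E$ is $$\mathcal{H}^{2\alpha}_E(x)=\int_{\mathbb{R}^n}\frac{\chi_E(\bar x)-\chi_{E^C}(\bar x)}{|x-\bar x|^{n+2\alpha}}\,d\bar x,\qquad E^C=\mathbb{R}^n\setminus E,$$ understood in the principal value sense, i.e. as $\lim_{r\to0}\int_{\{|\bar x-x|\ge r\}}$. The nonlocal mean curvature $\mathcal{H}^{2\alpha}_{H_\lambda}$ of the surface $H_\lambda$ is that of the set $E=E_+$ bounded by it, i.e. $$\mathcal{H}^{2\alpha}_{H_\lambda}(x)=\lim_{r\to0}\int_{\{|\bar x-x|\ge r\}}\frac{\chi_{E_+}(\bar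 x)-\chi_{E_-}(\bar x)}{|\bar x-x|^{3+2\alpha}}\,d\bar x .$$ *)

(* Defs.v *)
From HB Require Import structures.
From mathcomp Require Import all_boot all_order all_algebra.
From mathcomp Require Import all_classical all_reals all_analysis.

Set Implicit Arguments.
Unset Strict Implicit.
Unset Printing Implicit Defensive.

Import Order.TTheory GRing.Theory Num.Theory.
Import numFieldNormedType.Exports.

Local Open Scope classical_set_scope.
Local Open Scope ring_scope.

Section NonlocalMeanCurvature.
Context {R : realType}.
Implicit Types (lambda alpha r v : R).

(* R^3 = C x R, where the complex number a + ib is the pair (a, b). *)
Definition R3 := (R * R * R)%type.

(* The canonical norm on a product type is the sup norm, hence an explicit
   Euclidean distance. *)
Definition eucl_dist (x y : R3) : R :=
  Num.sqrt ((x.1.1 - y.1.1) ^+ 2 + (x.1.2 - y.1.2) ^+ 2 + (x.2 - y.2) ^+ 2).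

Local Notation mu := (@lebesgue_measure R).

Definition truncated_nonlocal_mean_curvature alpha (E : set R3) (x : R3) r
    : \bar R :=
  (\int[(mu \x mu) \x mu]_(y in [set y : R3 | (r <= eucl_dist x y)%R])
    ((\1_E y - \1_(~` E) y) / eucl_dist x y `^ (3 + 2 * alpha))%:E)%E.

(* "The nonlocal mean curvature of E at x exists and equals v": the principal
   value is a convergence statement, so that no default value of a divergent
   limit can be involved.  Likewise an integrand whose positive and negative
   parts both have infinite integral yields -oo, never a finite value. *)
Definition has_nonlocal_mean_curvature alpha (E : set R3) (x : R3) v : Prop :=
  truncated_nonlocal_mean_curvature alpha E x r @[r --> 0^'+] --> v%:E.

(* (t * e^(i theta), h) *)
Definition cylindrical (t theta h : R) : R3 :=
  (t * cos theta, t * sin theta, h).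

Definition helicoid lambda : set R3 :=
  [set p | exists t theta, p = cylindrical t theta (lambda / pi * theta)].

Definition Eplus lambda : set R3 :=
  [set p | exists t theta z, [/\ 0 < t, 0 < z < pi &
     p = cylindrical t theta (lambda / pi * (theta + z))]].

(* The surface is oriented as the boundary of E_+.  The complement of E_+ is
   the disjoint union of E_- and the helicoid, which is Lebesgue-negligible, so
   this is also the principal value with numerator \1_(E_+) - \1_(E_-). *)
Definition has_helicoid_nonlocal_mean_curvature alpha lambda (x : R3) v : Prop :=
  has_nonlocal_mean_curvature alpha (Eplus lambda) x v.

End NonlocalMeanCurvature.

Arguments R3 : clear implicits.

(* Main.v *)
From HB Require Import structures.
Require Import Defs.
From mathcomp Require Import all_boot all_order all_algebra.
From mathcomp Require Import all_classical all_reals all_analysis.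
From mathcomp Require Import measurable_realfun.
From mathcomp Require Import ring lra.

Import Order.TTheory GRing.Theory Num.Theory.
Import numFieldNormedType.Exports.

Set Implicit Arguments.
Unset Strict Implicit.
Unset Printing Implicit Defensive.

Local Open Scope classical_set_scope.
Local Open Scope ring_scope.

(** Through every point [x] of the helicoid passes a horizontal line contained
    in it, namely { (s e^(i theta), h) : s in R } with h = lambda theta / pi.
    The half-turn [rho] about this line is an isometry of R^3 that fixes [x],
    preserves the helicoid and exchanges the two sides E_+ and E_-.  Hence the
    integrand of the truncated curvature changes sign under [rho], and, for
    every truncation radius r > 0, the truncated integral vanishes: the
    principal value is the limit of a function that is identically zero.

    Four facts make this rigorous.

    - E_+ is the set where a sin phi > b cos phi, with phi = pi z / lambda, for
      the point (a, b, z): the difference of the two sides is, up to the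
      factor t > 0, the sine of the vertical offset ([EplusE]).  This
      function is odd under [rho] ([helicoid_eqn_half_turn]).
    - The half-turn preserves Lebesgue measure
      ([measure_preserving_half_turn]).  Its horizontal part is a plane
      reflection, a product of a coordinate reflection and three shears; a
      shear preserves area because it translates each fibre (Cavalieri).
    - The helicoid, on which the integrand is not odd, is null
      ([helicoid_eqn0_null]): each horizontal slice is a line.
    - The truncated integrand is integrable ([integrable_nonlocal_kernel]).
      Without this the cancellation would be between two infinite integrals.
      Far from [x] the kernel
      |x - y|^-(3 + 2 alpha) is dominated by a product of three functions of
      one coordinate each, (1 + |y_i|)^-(1 + 2 alpha / 3), so that Tonelli's
      theorem reduces the question to the real line. *)

(** * Products of sigma-finite measures *)

Section ProductSigmaFinite.
Context {R : realType} d1 d2 (T1 : measurableType d1) (T2 : measurableType d2).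
Variable m1 : {sigma_finite_measure set T1 -> \bar R}.
Variable m2 : {sigma_finite_measure set T2 -> \bar R}.
Local Open Scope ereal_scope.

(** The product measure under a new head constant, so that its sigma-finiteness
    can be found by inference when it is itself a factor of a product. *)
Definition sigma_finite_product : set (T1 * T2) -> \bar R := m1 \x m2.

HB.instance Definition _ := Measure.copy sigma_finite_product (m1 \x m2).

Let sigma_finite_productT : sigma_finite setT sigma_finite_product.
Proof.
have [F TF Foo] := sigma_finiteT m1; have [G TG Goo] := sigma_finiteT m2.
(* An enumeration of the pairs of indices; numbers that encode no pair give
   (0, 0), which only repeats a rectangle. *)
pose ij n := odflt (0, 0)%N (unpickle n).
exists (fun n => F (ij n).1 `*` G (ij n).2) => [|n].
  apply/esym/seteqP; split=> // -[x y] _.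
  have [i _ Fx] : (\bigcup_k F k) x by rewrite -TF.
  have [j _ Gy] : (\bigcup_k G k) y by rewrite -TG.
  by exists (pickle (i, j)) => //; rewrite /ij pickleK.
have [mF Flty] := Foo (ij n).1; have [mG Glty] := Goo (ij n).2.
split; first exact: measurableX.
rewrite [X in X < _](product_measure1E _ _ mF mG).
by rewrite lte_mul_pinfty// ge0_fin_numE.
Qed.

HB.instance Definition _ := Measure_isSigmaFinite.Build _ _ _
  sigma_finite_product sigma_finite_productT.

End ProductSigmaFinite.

(** * Measure-preserving maps *)

Section MeasurePreserving.
Context {R : realType}.
Local Open Scope ereal_scope.

Definition measure_preserving d (T : measurableType d) (m : set T -> \bar R)
    (f : T -> T) :=
  measurable_fun [set: T] f /\
  forall A, measurable A -> m (f @^-1` A) = m A.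

Lemma measure_preserving_comp d (T : measurableType d) (m : set T -> \bar R)
    (f g : T -> T) :
  measure_preserving m f -> measure_preserving m g ->
  measure_preserving m (f \o g).
Proof.
move=> [mf fm] [mg gm]; split; first exact: measurableT_comp.
move=> A mA; rewrite comp_preimage gm ?fm//.
by rewrite -[_ @^-1` _]setTI; exact: mf.
Qed.

Lemma measure_preserving_prod d1 d2 (T1 : measurableType d1)
    (T2 : measurableType d2) (m1 : {sigma_finite_measure set T1 -> \bar R})
    (m2 : {sigma_finite_measure set T2 -> \bar R}) (f : T1 -> T1)
    (g : T2 -> T2) :
  measure_preserving m1 f -> measure_preserving m2 g ->
  measure_preserving (m1 \x m2) (fun p => (f p.1, g p.2)).
Proof.
move=> [mf fm] [mg gm].
have mfg : measurable_fun [set: T1 * T2] (fun p => (f p.1, g p.2)).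
  by apply: measurable_fun_pair; apply: measurableT_comp.
split=> // A mA; apply/esym.
pose mfg_mixin := isMeasurableFun.Build _ _ _ _ _ mfg.
pose fg : {mfun _ >-> _} := HB.pack (fun p : T1 * T2 => (f p.1, g p.2)) mfg_mixin.
apply: (@product_measure_unique _ _ _ _ R m1 m2 (pushforward (m1 \x m2) fg)) => //.
move=> B C mB mC; rewrite /pushforward.
transitivity ((m1 \x m2) ((f @^-1` B) `*` (g @^-1` C))) => //.
have mfB : measurable (f @^-1` B) by rewrite -[X in measurable X]setTI; exact: mf.
have mgC : measurable (g @^-1` C) by rewrite -[X in measurable X]setTI; exact: mg.
rewrite (product_measure1E _ _ mfB mgC).
by congr (_ * _); [exact: fm|exact: gm].
Qed.

Lemma measure_preserving_swap d (T : measurableType d)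
    (m : {sigma_finite_measure set T -> \bar R}) :
  measure_preserving (m \x m) (fun p => (p.2, p.1)).
Proof.
have msw : measurable_fun [set: T * T] (fun p => (p.2, p.1)).
  by apply: measurable_fun_pair.
split=> // A mA; apply/esym.
pose msw_mixin := isMeasurableFun.Build _ _ _ _ _ msw.
pose sw : {mfun _ >-> _} := HB.pack (fun p : T * T => (p.2, p.1)) msw_mixin.
apply: (@product_measure_unique _ _ _ _ R m m (pushforward (m \x m) sw)) => //.
move=> B C mB mC; rewrite /pushforward.
transitivity ((m \x m) (C `*` B)).
  by congr (product_measure1 _ _ _); apply/seteqP; split=> p [].
by rewrite (product_measure1E _ _ mC mB) muleC.
Qed.

(** Cavalieri's principle: the measure of a set is the integral of the measures
    of its vertical slices, and each slice is moved inside its own fibre. *)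
Lemma measure_preserving_fiberwise d1 d2 (T1 : measurableType d1)
    (T2 : measurableType d2) (m1 : {sigma_finite_measure set T1 -> \bar R})
    (m2 : {sigma_finite_measure set T2 -> \bar R}) (F : T1 -> T2 -> T2) :
  measurable_fun [set: T1 * T2] (fun p => F p.1 p.2) ->
  (forall x, measure_preserving m2 (F x)) ->
  measure_preserving (m1 \x m2) (fun p => (p.1, F p.1 p.2)).
Proof.
move=> mF Fm; split; first exact: measurable_fun_pair.
move=> A mA; apply: eq_integral => x _ /=.
have [_ /(_ (xsection A x) (measurable_xsection x mA)) <-] := Fm x.
by congr (m2 _); apply/seteqP; split=> y; rewrite /xsection/= !inE.
Qed.

Local Notation mu := (@lebesgue_measure R).

Lemma measure_preserving_opp :
  measure_preserving mu (-%R : measurableTypeR R -> measurableTypeR R).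
Proof. by split=> // A mA; exact: lebesgue_measureN. Qed.

Lemma measure_preserving_translation (a : R) :
  measure_preserving mu (fun x : measurableTypeR R => x + a)%R.
Proof.
pose tr (x : measurableTypeR R) : measurableTypeR R := (x + a)%R.
have mt : measurable_fun [set: measurableTypeR R] tr by exact: measurable_funD.
pose mt_mixin := isMeasurableFun.Build _ _ _ _ _ mt.
pose mtr : {mfun measurableTypeR R >-> measurableTypeR R} := HB.pack tr mt_mixin.
split=> // A mA; apply/esym; rewrite -[RHS]/(pushforward mu mtr A).
apply: lebesgue_measure_unique => // _ [[u v]] _ <-.
rewrite /pushforward/=.
rewrite [X in _ = mu X](_ : _ = `](u - a)%R, (v - a)%R]%classic); last first.
  by apply/seteqP; split=> x /=; rewrite !in_itv/= ltrBlDr lerBrDr.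
rewrite !lebesgue_measure_itv/= !lte_fin ltrD2r -!EFinB.
by congr (if _ then (_%:E) else _); ring.
Qed.

Local Notation mu2 := (mu \x mu).

Lemma measure_preserving_vshear (a : R) :
  measure_preserving mu2 (fun p => (p.1, p.2 + a * p.1)%R).
Proof.
pose F (x y : measurableTypeR R) : measurableTypeR R := (y + a * x)%R.
apply: (@measure_preserving_fiberwise _ _ _ _ mu mu F).
  by apply: measurable_funD => //; apply: measurable_funM.
by move=> x; exact: measure_preserving_translation.
Qed.

Lemma measure_preserving_hshear (a : R) :
  measure_preserving mu2 (fun p => (p.1 + a * p.2, p.2)%R).
Proof.
have := measure_preserving_comp (measure_preserving_swap mu)
  (measure_preserving_comp (measure_preserving_vshear a)
    (measure_preserving_swap mu)).
by apply.
Qed.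

(** The reflection with eigenvectors at angles theta / 2 and (theta + pi) / 2,
    where (c, s) = (cos theta, sin theta), is the reflection (x, y) |-> (x, - y)
    followed by the rotation by theta; the latter is a product of three
    shears, of coefficients - tan (theta / 2), sin theta, - tan (theta / 2). *)
Lemma measure_preserving_reflection (c s : R) : (c ^+ 2 + s ^+ 2 = 1)%R ->
  measure_preserving mu2 (fun p => (c * p.1 + s * p.2, s * p.1 - c * p.2)%R).
Proof.
have measure_preserving_id : measure_preserving mu id by split.
move=> cs1; have [c1|c1] := eqVneq (1 + c)%R 0%R.
  (* The angle pi, whose half has no tangent. *)
  have c_N1 : c = (- 1)%R by lra.
  have s0 : s = 0%R by move: cs1; rewrite c_N1; nra.
  have := measure_preserving_prod measure_preserving_opp measure_preserving_id.
  congr measure_preserving; apply/funext => -[x y] /=.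
  by rewrite c_N1 s0; congr pair; ring.
(* The tangent of the half angle. *)
pose t := (s / (1 + c))%R.
have := measure_preserving_comp (measure_preserving_hshear (- t)%R)
  (measure_preserving_comp (measure_preserving_vshear s)
    (measure_preserving_comp (measure_preserving_hshear (- t)%R)
      (measure_preserving_prod measure_preserving_id measure_preserving_opp))).
have st : (s * t = 1 - c)%R.
  by apply: (mulIf c1); rewrite /t mulrA divfK//; move: cs1; lra.
have ct : (t * (1 + c) = s)%R by rewrite /t divfK.
congr measure_preserving; apply/funext => -[x y] /=; congr pair.
- have : (s * t * (x + t * y) = (1 - c) * (x + t * y))%R by rewrite st.
  by have := congr1 (fun w => w * y)%R ct; lra.
- have : (s * t * y = (1 - c) * y)%R by rewrite st.
  by lra.
Qed.

End MeasurePreserving.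

(** * Integrals of odd functions *)

Section OddIntegral.
Context {R : realType}.
Local Open Scope ereal_scope.

(** The map [rho] carries the positive part of [f] to its negative part, up to
    a null set, so both have the same integral; integrability makes this
    integral finite, whence the difference is 0 and not oo - oo. *)
Lemma integral_antisymmetric d (T : measurableType d)
    (m : {measure set T -> \bar R}) (rho : T -> T) (D N : set T)
    (f : T -> \bar R) :
  measure_preserving m rho -> measurable D -> rho @^-1` D = D ->
  measurable N -> m N = 0 -> m.-integrable D f ->
  (forall y, ~ N y -> f (rho y) = - f y) ->
  \int[m]_(y in D) f y = 0.
Proof.
move=> [mrho rhom] mD rhoD mN N0 fint fodd.
have mf : measurable_fun D f by exact: measurable_int fint.
have mfrho : measurable_fun D (f \o rho).
  apply: (measurable_comp mD) => //; last exact: measurable_funTS.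
  by move=> _ [y Dy <-]; rewrite -rhoD in Dy.
have posneg : \int[m]_(y in D) f^\+ y = \int[m]_(y in D) f^\- y.
  transitivity (\int[pushforward m rho]_(y in D) f^\+ y).
    by apply: eq_measure_integral => A mA _; rewrite /= /pushforward rhom.
  rewrite ge0_integral_pushforward//; last exact: measurable_funepos.
  rewrite rhoD; apply: ae_eq_integral => //.
  - rewrite -funepos_comp; exact: measurable_funepos.
  - exact: measurable_funeneg.
  - exists N; split=> // y /= yP; apply: contrapT => Ny; apply: yP => _.
    by rewrite funeposE funenegE fodd.
rewrite integralE posneg subee//.
exact: integrable_neg_fin_num.
Qed.

End OddIntegral.

(** * An integrable power on the line *)

Section Decay.
Context {R : realType}.
Local Notation mu := (@lebesgue_measure R).

Definition decay (b u : R) : R := (1 + `|u|) `^ (- (1 + b)).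

Lemma decay_ge0 b u : 0 <= decay b u.
Proof. exact: powR_ge0. Qed.

Lemma continuous_decay b : continuous (decay b).
Proof.
move=> u; apply: (@continuous_comp _ _ _ (fun u : R => 1 + `|u|)
  (fun v : R => v `^ (- (1 + b)))).
  by apply: cvgD; [exact: cvg_cst|exact: norm_continuous].
apply: differentiable_continuous; apply/derivable1_diffP.
by apply: derivable_powR; rewrite in_itv/= andbT; apply: ltr_pwDl.
Qed.

Lemma powR_cvgy0 (b : R) : 0 < b ->
  (1 + u) `^ (- b) @[u --> +oo] --> (0 : R).
Proof.
move=> b0; under eq_cvg do rewrite powRN.
apply/gtr0_cvgV0; first by near=> u; apply: powR_gt0; apply: ltr_pwDl.
apply/cvgryPge => A; near=> u.
apply: (le_trans (ler_norm A)).
have -> : `|A| = (`|A| `^ b^-1) `^ b.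
  by rewrite -powRrM mulVf ?powRr1// gt_eqF.
apply: ge0_ler_powR; rewrite ?nnegrE ?powR_ge0//; first exact: ltW.
  by rewrite addr_ge0//; near: u; apply: nbhs_pinfty_ge; exact: num_real.
apply: (@le_trans _ _ u); last by rewrite lerDr.
by near: u; apply: nbhs_pinfty_ge; exact: num_real.
Unshelve. all: by end_near. Qed.

Let primitive b (u : R) : R := - b^-1 * (1 + u) `^ (- b).

Lemma is_derive_primitive b (u : R) : 0 < b -> 0 <= u ->
  is_derive u 1 (primitive b) (decay b u).
Proof.
move=> b0 u0; have u1 : 0 < 1 + u by apply: ltr_pwDl.
have dpow := is_derive1_powR (- b) u1.
have dshift : is_derive u (1 : R) (fun v : R => 1 + v) 1.
  have := is_deriveD (is_derive_cst (1 : R) u (1 : R)) (is_derive_id u (1 : R)).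
  by rewrite add0r.
have dcomp := is_derive1_comp (f := fun v : R => v `^ (- b)) dpow dshift.
have dprim := is_deriveZ (- b^-1) dcomp; apply: (is_derive_eq dprim).
rewrite /decay ger0_norm// mulr1 -[LHS]/(- b^-1 * (- b * _)) mulrA mulrNN.
by rewrite mulVf ?gt_eqF// mul1r; congr (_ `^ _); ring.
Qed.

(** By parity the integral is twice that over the half-line, where the
    function has a primitive that vanishes at infinity. *)
Lemma integrable_decay b : 0 < b -> mu.-integrable setT (EFin \o decay b).
Proof.
move=> b0; have mw : measurable_fun setT (decay b).
  by apply: continuous_measurable_fun; exact: continuous_decay.
apply/integrableP; split; first exact/measurable_EFinP.
under eq_integral do rewrite /= ger0_norm ?decay_ge0//.
rewrite ge0_symfun_integralT; last 3 first.
- exact: decay_ge0.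
- exact: continuous_decay.
- by move=> u; rewrite /decay/= normrN.
rewrite -set_itvcy.
rewrite (@ge0_continuous_FTC2y _ _ (primitive b) 0 0).
- by rewrite -EFinB -EFinM ltry.
- by move=> u _; exact: decay_ge0.
- by apply: continuous_subspaceT; exact: continuous_decay.
- rewrite -[0 in X in _ --> X](mulr0 (- b^-1)); apply: cvgM; first exact: cvg_cst.
  exact: powR_cvgy0.
- by move=> u /ltW u0; apply: ex_derive; exact: is_derive_primitive.
- apply: cvg_at_right_filter; apply: differentiable_continuous.
  apply/derivable1_diffP; apply: ex_derive; exact: is_derive_primitive.
- move=> u; rewrite in_itv/= andbT => /ltW u0; rewrite derive1E.
  by apply: derive_val; exact: is_derive_primitive.
Qed.

End Decay.

(** * The helicoid and its half-turns *)

Section HalfTurn.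
Context {R : realType}.
Implicit Types (lambda alpha r theta : R) (p x y : R3 R).

(** With w = a + ib the horizontal part of [p] and phi the angle of the helicoid
    at the height of [p], this is - Im (w e^(- i phi)). *)
Definition helicoid_eqn lambda p : R :=
  p.1.1 * sin (pi / lambda * p.2) - p.1.2 * cos (pi / lambda * p.2).

Let mul_ratiosK (a b v : R) : a != 0 -> b != 0 -> a / b * (b / a * v) = v.
Proof. by move=> a0 b0; field; rewrite a0 b0. Qed.

(** A point of E_+ at angle theta and offset z is at a height of angle
    phi = theta + z, so w e^(- i phi) = t e^(- i z), with t > 0 and 0 < z < pi:
    these are the polar coordinates of the open lower half-plane. *)
Lemma EplusE lambda : 0 < lambda ->
  Eplus lambda = [set p | 0 < helicoid_eqn lambda p].
Proof.
move=> l0; have l_neq0 : lambda != 0 by rewrite gt_eqF.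
have pi_neq0 : (pi : R) != 0 by rewrite gt_eqF ?pi_gt0.
apply/seteqP; split=> [_ [t [theta [z [t0 zpi ->]]]]|[[a b] h]] /=.
  rewrite /helicoid_eqn /cylindrical/=.
  rewrite mul_ratiosK//.
  suff -> : t * cos theta * sin (theta + z) - t * sin theta * cos (theta + z) =
      t * sin z by rewrite mulr_gt0// sin_gt0_pi.
  rewrite sinD cosD -[RHS]mulr1 -(cos2Dsin2 theta); ring.
rewrite /helicoid_eqn/=; set phi := pi / lambda * h => g0.
(* w e^(- i phi) = u - i v, of modulus t and argument - z. *)
set v := _ - _ in g0; pose u := a * cos phi + b * sin phi.
have cs1 := cos2Dsin2 phi.
have aE : a = cos phi * u + sin phi * v.
  by rewrite /u /v -[LHS]mulr1 -cs1; ring.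
have bE : b = sin phi * u - cos phi * v.
  by rewrite /u /v -[LHS]mulr1 -cs1; ring.
pose t := Num.sqrt (u ^+ 2 + v ^+ 2).
have uv0 : 0 < u ^+ 2 + v ^+ 2 by rewrite ltr_wpDl ?sqr_ge0// exprn_gt0.
have t0 : 0 < t by rewrite sqrtr_gt0.
have t2 : t ^+ 2 = u ^+ 2 + v ^+ 2 by rewrite sqr_sqrtr// ltW.
have t_neq0 : t != 0 by rewrite gt_eqF.
have ut : `|u / t| < 1.
  rewrite normrM normfV (gtr0_norm t0) ltr_pdivrMr// mul1r.
  rewrite -ltr_sqr ?nnegrE ?(ltW t0)// real_normK ?num_real// t2.
  by rewrite ltrDl exprn_gt0.
have {ut} /andP[ut1 ut2] : -1 < u / t < 1 by rewrite -ltr_norml.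
pose z := acos (u / t).
have cosz : cos z = u / t by rewrite acosK// in_itv/= !ltW.
have sinz : sin z = v / t.
  rewrite sin_acos ?(ltW ut1) ?(ltW ut2)//.
  have -> : 1 - (u / t) ^+ 2 = (v / t) ^+ 2.
    by rewrite !expr_div_n t2; field; rewrite gt_eqF.
  by rewrite sqrtr_sqr ger0_norm// divr_ge0// ltW.
exists t, (phi - z), z; split => //.
  by rewrite acos_gt0 ?acos_ltpi ?ut1 ?ut2 ?ltW.
rewrite /cylindrical cosB sinB cosz sinz subrK; congr (_, _, _).
- by rewrite {1}aE; field.
- by rewrite {1}bE; field.
- by rewrite mul_ratiosK.
Qed.

(** The rotation by pi about the horizontal line at height [h] and angle theta
    through the vertical axis, where (c, s) = (cos (2 theta), sin (2 theta)). *)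
Definition half_turn c s h p : R3 R :=
  (c * p.1.1 + s * p.1.2, s * p.1.1 - c * p.1.2, 2 * h - p.2).

Lemma eucl_dist_half_turn c s h x y : c ^+ 2 + s ^+ 2 = 1 ->
  eucl_dist (half_turn c s h x) (half_turn c s h y) = eucl_dist x y.
Proof.
move=> cs1; rewrite /eucl_dist /=; congr Num.sqrt.
set X := x.1.1; set Y := x.1.2; set A := y.1.1; set B := y.1.2.
rewrite -[(X - A) ^+ 2]mulr1 -[(Y - B) ^+ 2]mulr1 -cs1; ring.
Qed.

Lemma half_turn_fixed t theta h :
  half_turn (cos (theta + theta)) (sin (theta + theta)) h (cylindrical t theta h) =
  cylindrical t theta h.
Proof.
have cs1 := cos2Dsin2 theta.
rewrite /half_turn /cylindrical/= cosD sinD; congr (_, _, _).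
- by rewrite -[RHS]mulr1 -cs1; ring.
- by rewrite -[RHS]mulr1 -cs1; ring.
- by ring.
Qed.

(** The half-turn sends w to e^(2 i theta) times the conjugate of w, and phi to
    2 theta - phi; hence it conjugates w e^(- i phi). *)
Lemma helicoid_eqn_half_turn lambda theta p : lambda != 0 ->
  helicoid_eqn lambda (half_turn (cos (theta + theta)) (sin (theta + theta))
    (lambda / pi * theta) p) = - helicoid_eqn lambda p.
Proof.
move=> l0; have pi_neq0 : (pi : R) != 0 by rewrite gt_eqF ?pi_gt0.
rewrite /helicoid_eqn /=.
have -> : pi / lambda * (2 * (lambda / pi * theta) - p.2) =
    (theta + theta) - pi / lambda * p.2.
  by rewrite mulrBr mulrCA mul_ratiosK//; ring.
rewrite sinB cosB; set c := cos (theta + theta); set s := sin (theta + theta).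
have cs1 : c ^+ 2 + s ^+ 2 = 1 by exact: cos2Dsin2.
set C := cos _; set S := sin _.
rewrite -[RHS]mulr1 -cs1; ring.
Qed.

End HalfTurn.

(** * Measure theory of the half-turn and of the helicoid *)

Section Measure3.
Context {R : realType}.
Local Notation mu := (@lebesgue_measure R).
Local Notation mu2 := (sigma_finite_product mu mu).
Local Notation mu3 := ((mu \x mu) \x mu)%E.
Local Notation M := (measurableTypeR R).
Implicit Types (lambda alpha r : R) (x : R3 R).

Lemma measure_preserving_half_turn (c s h : R) : c ^+ 2 + s ^+ 2 = 1 ->
  measure_preserving mu3 (half_turn c s h).
Proof.
move=> cs1; have hflip := measure_preserving_comp
  (measure_preserving_translation (2 * h)) (@measure_preserving_opp R).
have hrefl : measure_preserving mu2 _ := measure_preserving_reflection cs1.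
have := measure_preserving_prod hrefl hflip.
by congr measure_preserving; apply/funext => p; congr pair; exact: addrC.
Qed.

Lemma measurable_helicoid_eqn lambda :
  measurable_fun [set: M * M * M] (helicoid_eqn lambda : M * M * M -> M).
Proof.
have mphase : measurable_fun [set: M * M * M]
    (fun p => pi / lambda * p.2 : M) by apply: measurable_funM.
apply: measurable_funB; apply: measurable_funM.
- by apply: measurableT_comp.
- apply: measurableT_comp => //; apply: continuous_measurable_fun.
  exact: continuous_sin.
- by apply: measurableT_comp.
- apply: measurableT_comp => //; apply: continuous_measurable_fun.
  exact: continuous_cos.
Qed.

Lemma measurable_helicoid_eqn_pos lambda :
  measurable ([set p | 0 < helicoid_eqn lambda p] : set (M * M * M)).
Proof.
rewrite (_ : [set _ | _] = helicoid_eqn lambda @^-1` `]0, +oo[%classic).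
  by rewrite -[X in measurable X]setTI; exact: measurable_helicoid_eqn.
by apply/seteqP; split=> p /=; rewrite in_itv/= andbT.
Qed.

Lemma measurable_helicoid_eqn0 lambda :
  measurable ([set p | helicoid_eqn lambda p = 0] : set (M * M * M)).
Proof.
rewrite (_ : [set _ | _] = helicoid_eqn lambda @^-1` [set 0])//.
rewrite -[X in measurable X]setTI; exact: measurable_helicoid_eqn.
Qed.

(** The slice at height z is the line spanned by (cos phi, sin phi), which a
    reflection carries to the horizontal axis. *)
Lemma helicoid_eqn0_null lambda :
  mu3 [set p | helicoid_eqn lambda p = 0] = 0%E.
Proof.
pose N : set (M * M * M) := [set p | helicoid_eqn lambda p = 0].
have mN : measurable N by exact: measurable_helicoid_eqn0.
rewrite (@product_measure_unique _ _ _ _ _ mu2 mu (mu2 \x^ mu)%E)//; last first.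
  by move=> A B mA mB; rewrite /= product_measure2E.
apply: integral0_eq => z _ /=.
pose phi := pi / lambda * z.
have [_ refl] := measure_preserving_reflection (cos2Dsin2 phi).
rewrite (_ : ysection _ z = (fun p : M * M =>
    (cos phi * p.1 + sin phi * p.2, sin phi * p.1 - cos phi * p.2)) @^-1`
    (setT `*` [set 0])).
  transitivity ((mu \x mu)%E ([set: M] `*` [set 0 : M])).
    by apply: refl; exact: measurableX.
  rewrite product_measure1E// -[RHS](mule0 (mu setT)); congr (_ * _)%E.
  exact: lebesgue_measure_set1.
apply/seteqP; split => p; rewrite /ysection/= inE /helicoid_eqn/= -/phi.
  by move=> <-; split=> //=; ring.
by move=> [_ <-]; ring.
Qed.

(** * Integrability of the truncated kernel *)

Lemma integrable_prod d1 d2 (T1 : measurableType d1) (T2 : measurableType d2)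
    (m1 : {sigma_finite_measure set T1 -> \bar R})
    (m2 : {sigma_finite_measure set T2 -> \bar R}) (f : T1 -> R) (g : T2 -> R) :
  m1.-integrable setT (EFin \o f) -> m2.-integrable setT (EFin \o g) ->
  (m1 \x m2)%E.-integrable setT (fun p => (f p.1 * g p.2)%:E).
Proof.
move=> /integrableP[/measurable_EFinP mf fint].
move=> /integrableP[/measurable_EFinP mg gint].
apply/integrable12ltyP.
  by apply/measurable_EFinP; apply: measurable_funM; apply: measurableT_comp.
under eq_integral => x _.
  under eq_integral => y _ do rewrite /= normrM EFinM.
  rewrite ge0_integralZl//; last first.
    by apply/measurable_EFinP; exact: measurableT_comp.
  over.
rewrite ge0_integralZr//.
- by rewrite lte_mul_pinfty// ?integral_ge0// ge0_fin_numE// integral_ge0.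
- by apply/measurable_EFinP; exact: measurableT_comp.
- exact: integral_ge0.
Qed.

Definition decay3 (b : R) (p : R3 R) : R :=
  decay b p.1.1 * decay b p.1.2 * decay b p.2.

Lemma integrable_decay3 b : 0 < b ->
  mu3.-integrable [set: M * M * M] (EFin \o decay3 b).
Proof.
move=> b0; have db := integrable_decay b0.
have db2 : mu2.-integrable setT (fun p => (decay b p.1 * decay b p.2)%:E).
  exact: (integrable_prod db db).
exact: (integrable_prod db2 db).
Qed.

Lemma measurable_eucl_dist x :
  measurable_fun [set: M * M * M] (eucl_dist x : M * M * M -> M).
Proof.
apply: (@measurableT_comp _ _ _ _ _ _ (@Num.sqrt R : M -> M)).
  by apply: continuous_measurable_fun; exact: sqrt_continuous.
apply: measurable_funD; [apply: measurable_funD|]; apply: measurable_funX;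
  apply: measurable_funB => //; exact: measurableT_comp.
Qed.

Lemma eucl_dist_ge x y :
  [/\ `|x.1.1 - y.1.1| <= eucl_dist x y, `|x.1.2 - y.1.2| <= eucl_dist x y
    & `|x.2 - y.2| <= eucl_dist x y].
Proof.
by split; rewrite -sqrtr_sqr ler_wsqrtr//;
  have := sqr_ge0 (x.1.1 - y.1.1); have := sqr_ge0 (x.1.2 - y.1.2);
  have := sqr_ge0 (x.2 - y.2); lra.
Qed.

(** Outside the ball of radius [r], a multiple C d of the distance d to [x]
    dominates each 1 + |y_i|; the exponent 3 + 2 alpha is then shared equally
    among the three coordinates, which leaves each of them more than 1. *)
Lemma powR_eucl_dist_le alpha r x : 0 < alpha -> 0 < r ->
  exists2 K, 0 <= K & forall y, r <= eucl_dist x y ->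
    (eucl_dist x y `^ (3 + 2 * alpha))^-1 <= K * decay3 (2 * alpha / 3) y.
Proof.
move=> a0 r0; set b := 2 * alpha / 3.
pose M0 := 1 + (`|x.1.1| + `|x.1.2| + `|x.2|).
have M0_ge0 : 0 <= M0 by rewrite !addr_ge0.
(* 1 + |y_i| <= 1 + |x_i| + d <= M0 + d <= (M0 / r) d + d. *)
pose C := M0 / r + 1.
have C0 : 0 < C by rewrite ltr_wpDl// divr_ge0// ltW.
exists (C `^ (3 + 2 * alpha)); first exact: powR_ge0.
move=> y ry; set d := eucl_dist x y.
have d0 : 0 < d by exact: lt_le_trans ry.
have Cd0 : 0 < C * d by rewrite mulr_gt0.
have b1 : 0 < 1 + b by rewrite ltr_pwDl// /b; lra.
have le_decay u v : `|u| + 1 <= M0 -> `|u - v| <= d ->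
    (C * d) `^ (- (1 + b)) <= decay b v.
  move=> uM uvd; have v1 : 0 < 1 + `|v| by rewrite ltr_pwDl.
  rewrite /decay !powRN lef_pV2 ?posrE ?powR_gt0//.
  apply: ge0_ler_powR; rewrite ?nnegrE ?(ltW b1) ?(ltW v1) ?(ltW Cd0)//.
  have : M0 <= M0 / r * d by rewrite mulrAC ler_pdivlMr// ler_wpM2l.
  have : `|v| <= `|u| + `|u - v|.
    by rewrite -{1}(subKr u v); exact: ler_normB.
  by rewrite /C mulrDl mul1r; lra.
have [d1 d2 d3] := eucl_dist_ge x y.
have := normr_ge0 x.1.1; have := normr_ge0 x.1.2; have := normr_ge0 x.2.
move=> x3 x2 x1.
have -> : (d `^ (3 + 2 * alpha))^-1 =
    C `^ (3 + 2 * alpha) * ((C * d) `^ (- (1 + b))) ^+ 3.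
  rewrite -powR_mulrn ?powR_ge0// -powRrM.
  have -> : - (1 + b) * 3%:R = - (3 + 2 * alpha) by rewrite /b; field.
  rewrite powRN powRM ?(ltW C0) ?(ltW d0)// invfM mulrA divff ?mul1r//.
  by rewrite gt_eqF ?powR_gt0.
rewrite ler_wpM2l ?powR_ge0// /decay3 exprS expr2 mulrA.
by apply: ler_pM; rewrite ?mulr_ge0 ?powR_ge0//;
  [apply: ler_pM; rewrite ?powR_ge0//|];
  apply: le_decay; try eassumption; rewrite /M0; lra.
Qed.

Lemma measurable_far x r :
  measurable ([set y | r <= eucl_dist x y] : set (M * M * M)).
Proof.
rewrite (_ : [set _ | _] = eucl_dist x @^-1` `[r, +oo[%classic).
  by rewrite -[X in measurable X]setTI; exact: measurable_eucl_dist.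
by apply/seteqP; split=> y /=; rewrite in_itv/= andbT.
Qed.

Lemma integrable_nonlocal_kernel alpha (E : set (M * M * M)) x r :
  0 < alpha -> 0 < r -> measurable E ->
  mu3.-integrable [set y | r <= eucl_dist x y]
    (fun y => ((\1_E y - \1_(~` E) y) / eucl_dist x y `^ (3 + 2 * alpha))%:E).
Proof.
move=> a0 r0 mE; have mD := measurable_far x r.
have [K K0 Kdecay] := powR_eucl_dist_le x a0 r0.
have b0 : 0 < 2 * alpha / 3 by lra.
have intK := integrableZl mD K (integrableS measurableT mD (@subsetT _ _)
  (integrable_decay3 b0)).
apply: le_integrable intK => //.
- apply/measurable_EFinP/measurable_funTS; apply: measurable_funM.
    by apply: measurable_funB; apply: measurable_indic => //; exact: measurableC.
  rewrite (_ : (fun _ => _) =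
    (fun y => eucl_dist x y `^ (- (3 + 2 * alpha)))); last first.
    by apply/funext => y; rewrite powRN.
  apply: (@measurableT_comp _ _ _ _ _ _ (@powR R ^~ (- (3 + 2 * alpha)))) => //.
  exact: measurable_eucl_dist.
- move=> y /= ry; rewrite lee_fin normrM [leRHS]ger0_norm; last first.
    by rewrite mulr_ge0// /decay3 !mulr_ge0 ?decay_ge0.
  rewrite normfV (ger0_norm (powR_ge0 _ _)).
  apply: le_trans (Kdecay y ry); rewrite ler_piMl ?invr_ge0 ?powR_ge0//.
  rewrite !indicE in_setC.
  by case: (y \in E); rewrite ?subr0 ?sub0r ?normrN normr1.
Qed.

End Measure3.

(** * The curvature vanishes *)

Theorem theorem1p3 (R : realType) (lambda alpha : R)
    (lambda_gt0 : 0 < lambda) (alpha_gt0 : 0 < alpha) (alpha_lt : alpha < 1 / 2)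
    (x : R3 R) (xH : helicoid lambda x) :
  has_helicoid_nonlocal_mean_curvature alpha lambda x 0.
Proof.
have l_neq0 : lambda != 0 by rewrite gt_eqF.
have [t [theta x_cyl]] := xH.
set h := lambda / pi * theta in x_cyl.
pose rho := half_turn (cos (theta + theta)) (sin (theta + theta)) h.
have cs1 := cos2Dsin2 (theta + theta).
have rho_x : rho x = x by rewrite x_cyl; exact: half_turn_fixed.
have rho_dist y : eucl_dist x (rho y) = eucl_dist x y.
  by rewrite -{1}rho_x; exact: eucl_dist_half_turn.
rewrite /has_helicoid_nonlocal_mean_curvature /has_nonlocal_mean_curvature.
apply: cvg_near_cst; near=> r.
have r0 : 0 < r by near: r; exact: nbhs_right_gt.
rewrite /truncated_nonlocal_mean_curvature EplusE//.
apply: (integral_antisymmetric (measure_preserving_half_turn h cs1)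
  (measurable_far x r) _ (measurable_helicoid_eqn0 lambda)
  (helicoid_eqn0_null lambda)
  (integrable_nonlocal_kernel x alpha_gt0 r0 (measurable_helicoid_eqn_pos lambda))).
  by apply/seteqP; split=> y /=; rewrite -/rho rho_dist.
move=> y /= /eqP gy0; rewrite -/rho rho_dist -mulNr opprB.
rewrite !indicE !in_setC.
rewrite (_ : (rho y \in _) = (y \notin [set p | 0 < helicoid_eqn lambda p])).
  by rewrite negbK.
apply/idP/idP; rewrite !inE/= /rho helicoid_eqn_half_turn// oppr_gt0.
  by move=> gy; rewrite notin_setE/= => /(lt_trans gy); rewrite ltxx.
by rewrite notin_setE/= => /negP; rewrite -leNgt lt_neqAle gy0.
Unshelve. all: by end_near. Qed.
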